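(* Let $(R,\mathfrak m)$ be a regular local ring of dimension $d\ge 1$. Let $I$ be an $\mathfrak m$-primary ideal of $R$. Take a minimal free resolution $0\to F_d\xrightarrow{\varphi_d}F_{d-1}\to\cdots\to F_1\xrightarrow{\varphi_1}F_0\to R/I\to0$ of the $R$-module $R/I$. Consider the following conditions. (1) The ideal $I$ is Burch. (2) There exist a regular system of parameters $x_1,\dots,x_d$ of $R$ and an integer $r>0$ such that $I_1(\varphi_d)=(x_1^r,x_2,\dots,x_d)$. (3) One has $(I:\mathfrak m)^2\neq I(I:\mathfrak m)$. Then the implication (1) $\Rightarrow$ (2) holds. If $R$ contains a field, then the implication (3) $\Rightarrow$ (2) holds. If $d=2$, then the implication (2) $\Rightarrow$ (1) holds as well.
   Context: An ideal $I$ of a local ring $(R,\mathfrak m)$ is a Burch ideal if $\mathfrak m I\neq\mathfrak m(I:_R\mathfrak m)$. For a linear map $\varphi$ of finitely generated free modules, $I_1(\varphi)$ is the ideal generated by the entries of a matrix representing $\varphi$. *)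

(* Defs.v *)
From HB Require Import structures.
From mathcomp Require Import all_boot all_order all_algebra.
From mathcomp Require Import generic_quotient ring_quotient.
From mathcomp Require Import boolp classical_sets.

Set Implicit Arguments.
Unset Strict Implicit.
Unset Printing Implicit Defensive.

Import GRing.Theory VectorInternalTheory.

Local Open Scope classical_set_scope.
Local Open Scope ring_scope.
Local Open Scope quotient_scope.

(* Ideals are sets of type [set R] satisfying [ideal], the unit ideal included:
   the structure [idealr] of ring_quotient only covers proper ideals, whereas
   colon ideals and generated ideals may be improper.  An [I : idealr R] is
   viewed as a set by [[set` I]]. *)

Section Ideals.
Variable R : comNzRingType.
Implicit Types (I J m : set R).

Definition ideal I : Prop :=
  I 0 /\ forall a u v, I u -> I v -> I (a * u + v).

Definition ideal_gen (S : set R) : set R := smallest ideal S.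

Definition ideal_mul I J : set R :=
  ideal_gen [set a * b | a in I & b in J].

Definition ideal_colon I J : set R :=
  [set a | forall b, J b -> I (a * b)].

Definition radical I : set R := [set a | exists n : nat, I (a ^+ n)].

Definition primary_ideal I : Prop :=
  [/\ ideal I, ~ I 1 &
      forall a b, I (a * b) -> I a \/ exists n : nat, I (b ^+ n)].

Definition m_primary m I : Prop := primary_ideal I /\ radical I = m.

Definition maximal_ideal m : Prop :=
  [/\ ideal m, ~ m 1 &
      forall J, ideal J -> ~ J 1 -> m `<=` J -> J = m].

Definition burch m I : Prop :=
  ideal_mul m I <> ideal_mul m (ideal_colon I m).

End Ideals.

Section RegularLocalRings.
Variable R : comNzRingType.

Definition noetherian : Prop :=
  forall J : set R, ideal J ->
    exists (n : nat) (x : 'I_n -> R), ideal_gen (range x) = J.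

Definition local_ring (m : set R) : Prop :=
  maximal_ideal m /\ forall m' : set R, maximal_ideal m' -> m' = m.

Definition prime_chain (n : nat) : Prop :=
  exists P : 'I_n.+1 -> prime_idealr R,
    forall i j : 'I_n.+1, (i < j)%N -> [set` P i] `<` [set` P j].

Definition krull_dim (d : nat) : Prop :=
  prime_chain d /\ forall n : nat, prime_chain n -> (n <= d)%N.

Definition regular_local_ring (m : set R) (d : nat) : Prop :=
  [/\ noetherian, local_ring m, krull_dim d &
      exists x : 'I_d -> R, ideal_gen (range x) = m].

(* Meaningful when [d] is the dimension of the regular local ring [(R, m)]. *)
Definition regular_sop (m : set R) (d : nat) (x : 'I_d -> R) : Prop :=
  ideal_gen (range x) = m.

Definition contains_field : Prop :=
  exists (K : fieldType) (f : {rmorphism K -> R}), injective f.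

End RegularLocalRings.

(* A [vectType R] is an R-module with an R-linear bijection [v2r] onto some
   R^n, that is, a finitely generated free module, and [f2mx phi] is the matrix
   of [phi : 'Hom(V, W)] in the bases given by [v2r]. *)

Section FreeModules.
Variable R : comNzRingType.

Lemma v2r_lfun (V W : vectType R) (phi : 'Hom(V, W)) (v : V) :
  v2r (phi v) = v2r v *m f2mx phi.
Proof. by rewrite unlock /= r2vK. Qed.

Definition I1 (V W : vectType R) (phi : 'Hom(V, W)) : set R :=
  ideal_gen [set f2mx phi i j | i in setT & j in setT].

Definition ideal_smul (J : set R) {V : vectType R} : set V :=
  [set v | exists (n : nat) (a : 'I_n -> R) (w : 'I_n -> V),
     (forall i, J (a i)) /\ v = \sum_i a i *: w i].

(* The map [phi i] is the differential F_(i+1) -> F_i, usually written with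
   index i+1; only F_0, ..., F_d and [phi 0], ..., [phi d.-1] are constrained.
   The augmentation [eps] is R-linear, R acting on R/I through the
   projection R -> R/I. *)
Definition minimal_free_resolution (m : set R) (I : idealr R) (d : nat)
    (F : nat -> vectType R) (phi : forall i : nat, 'Hom(F i.+1, F i))
    (eps : {linear F 0%N -> {ideal_quot I} | \pi_{ideal_quot I} \; *%R}) : Prop :=
  [/\ forall y : {ideal_quot I}, exists v, eps v = y,
      forall v, eps v = 0 <-> exists w, v = phi 0%N w,
      forall i : nat, (i.+1 < d)%N ->
        forall v, phi i v = 0 <-> exists w, v = phi i.+1 w,
      injective (phi d.-1) &
      forall i : nat, (i < d)%N -> range (phi i) `<=` ideal_smul m].

End FreeModules.

(* Main.v *)
Require Import Defs.
From HB Require Import structures.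
From mathcomp Require Import all_boot all_order all_algebra.
From mathcomp Require Import generic_quotient ring_quotient.
From mathcomp Require Import boolp classical_sets.
From mathcomp Require Import perm ring.

Set Implicit Arguments.
Unset Strict Implicit.
Unset Printing Implicit Defensive.

Import GRing.Theory VectorInternalTheory.

Local Open Scope classical_set_scope.
Local Open Scope ring_scope.
Local Open Scope quotient_scope.

(** Write [E] for the ideal [I1] of the last differential, [soc] for [(I : m)],
    and, for a regular system of parameters [x] and an index [k], [J_k] for the
    ideal generated by the [x_i] with [i != k].

    The heart of the proof is a dictionary between the linear part of the last
    differential and the socle of [R / I] ([socle_divisible_of_I1] and
    [I1_of_socle_divisible]):

      [E] is contained in [J_k + m x_k] if and only if
      [soc] is contained in [I + x_k (I : J_k)].

    To see it, let [S = R / J_k], a discrete valuation ring with uniformizer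
    [x_k].  Both sides compute Tor: dividing the resolution by one parameter
    after the other identifies its top homology modulo [J_k] with
    [(I : J_k) / I], and a further division by [x_k] identifies the last free
    module modulo [m] with the socle [(I : m) / I].  Under this identification
    a socle element [a] comes from [f] with [phi f = x_k w] modulo [J_k], where
    [w] is the class of [a].  The left hand side says that [w] is divisible by
    [x_k] for all [f], and since [S] is a domain and the resolution is free, the
    quotient is again a cycle: it is the class of some [b] in [(I : J_k)] with
    [a = x_k b] modulo [I].

    Choose [x] with as many members as possible in [E].  If at most one member
    [x_k] is missing, then [E] is generated by the others and a power of [x_k]:
    some power of [x_k] lies in [E], because otherwise the same argument with
    higher powers of [x_k] would give [soc = I].  This is condition (2).  If two
    members are missing, the dictionary applies to two indices [k1], [k2], and
    this excludes the two other conditions.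

    - If [a = x_k b] modulo [I], with [b] in [(I : J_k)], then for [i != k] the
      element [x_i a] lies in [m I], as [x_i b] is in [I].  With two indices [k]
      this covers all [i], so [m soc = m I] and [I] is not Burch.
    - If [a = x_k1 b] and [a' = x_k2 b'] modulo [I], then
      [x_k1 b x_k2 b' = (x_k2 b) (x_k1 b')] lies in [I I], so
      [soc soc = I soc].

    For the remaining implication, with [d = 2], the equality [m I = m soc] and
    the regularity of [x_0], [x_1] give the right hand side of the dictionary
    for [k = 1], hence [E] is contained in [(x_0) + m x_1], which does not
    contain [x_1].

    The dictionary needs that generators of [m] in number equal to the dimension
    form a regular sequence ([regular_init_gen_prime]).  This rests on Krull's
    principal ideal theorem, which is proved here with symbolic powers, and
    with saturations in [R] in the place of localizations. *)

(** * Ideals, prime ideals and saturations *)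

Section IdealCalculus.
Variable R : comNzRingType.
Implicit Types (I J K M N P Q : set R) (a b c g s t x : R).

Lemma ideal0 J : ideal J -> J 0. Proof. by case. Qed.

Lemma idealM J a u : ideal J -> J u -> J (a * u).
Proof. by move=> [J0 Jlin] Ju; rewrite -[_ * _]addr0; exact: Jlin. Qed.

Lemma idealMr J a u : ideal J -> J u -> J (u * a).
Proof. by move=> Jid Ju; rewrite mulrC; exact: idealM. Qed.

Lemma idealD J u v : ideal J -> J u -> J v -> J (u + v).
Proof. by move=> [J0 Jlin] Ju Jv; rewrite -[u]mul1r; exact: Jlin. Qed.

Lemma idealB J u v : ideal J -> J u -> J v -> J (u - v).
Proof.
by move=> [J0 Jlin] Ju Jv; rewrite addrC -mulN1r; exact: Jlin.
Qed.

Lemma idealBr J u v : ideal J -> J (u - v) -> J v -> J u.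
Proof. by move=> Jid Juv Jv; rewrite -[u](subrK v); exact: idealD. Qed.

Lemma ideal_sum J n (f : 'I_n -> R) :
  ideal J -> (forall i, J (f i)) -> J (\sum_i f i).
Proof.
move=> Jid Jf; elim/big_ind: _ => //; first exact: ideal0.
by move=> u v; exact: idealD.
Qed.

Lemma ideal_full J a : ideal J -> J 1 -> J a.
Proof. by move=> Jid J1; rewrite -[a]mulr1; exact: idealM. Qed.

Lemma ideal_gen_ideal (S : set R) : ideal (ideal_gen S).
Proof.
split=> [J [Jid _]|a u v Su Sv J JS]; first exact: ideal0.
by apply: (proj2 JS.1); [exact: Su|exact: Sv].
Qed.

Lemma ideal_gen_mem (S : set R) a : S a -> ideal_gen S a.
Proof. by move=> Sa J [_ SJ]; exact: SJ. Qed.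

Lemma ideal_gen_sub (S J : set R) : ideal J -> S `<=` J -> ideal_gen S `<=` J.
Proof. exact: smallest_sub. Qed.

Lemma ideal_mul_ideal I J : ideal (ideal_mul I J).
Proof. exact: ideal_gen_ideal. Qed.

Lemma ideal_mul_mem I J a b : I a -> J b -> ideal_mul I J (a * b).
Proof. by move=> Ia Jb; apply: ideal_gen_mem; exists a => //; exists b. Qed.

Lemma ideal_mul_sub I J K : ideal K ->
  (forall a b, I a -> J b -> K (a * b)) -> ideal_mul I J `<=` K.
Proof.
move=> Kid IJK; apply: ideal_gen_sub => // _ [a Ia [b Jb <-]].
exact: IJK.
Qed.

Lemma ideal_colon_ideal I J : ideal I -> ideal (ideal_colon I J).
Proof.
move=> Iid; split=> [b _|a u v Iu Iv b Jb]; first by rewrite mul0r; case: Iid.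
by rewrite mulrDl -mulrA; apply: (proj2 Iid); [exact: Iu|exact: Iv].
Qed.

(** The coefficients of [g] are restricted to [A] because besides [N + (g)] the
    ideals [N + Q g], with [Q] the maximal ideal at hand, are needed. *)
Definition adjoin (A N : set R) g : set R :=
  [set a | exists c n, [/\ A c, N n & a = n + c * g]].

Lemma adjoin_ideal A N g : ideal A -> ideal N -> ideal (adjoin A N g).
Proof.
move=> Aid Nid; split.
  by exists 0, 0; split; [exact: ideal0|exact: ideal0|rewrite mul0r addr0].
move=> a _ _ [c [n [Ac Nn ->]]] [c' [n' [Ac' Nn' ->]]].
exists (a * c + c'), (a * n + n'); split; last by ring.
  exact: (proj2 Aid).
exact: (proj2 Nid).
Qed.

Lemma setT_ideal : ideal [set: R]. Proof. by []. Qed.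
#[local] Hint Resolve setT_ideal : core.

Lemma adjoin_sub A N g : ideal A -> N `<=` adjoin A N g.
Proof.
by move=> Aid n Nn; exists 0, n; split; [exact: ideal0| |rewrite mul0r addr0].
Qed.

Lemma adjoin_mem A N g c : ideal N -> A c -> adjoin A N g (c * g).
Proof. by move=> Nid Ac; exists c, 0; split; [|exact: ideal0|rewrite add0r]. Qed.

Lemma adjoin_gen N g : ideal N -> adjoin setT N g g.
Proof. by move=> Nid; rewrite -{2}[g]mul1r; exact: adjoin_mem. Qed.

Lemma adjoin_min A N g J :
  ideal J -> N `<=` J -> (forall c, A c -> J (c * g)) ->
  adjoin A N g `<=` J.
Proof.
move=> Jid NJ AJ _ [c [n [Ac Nn ->]]].
by apply: idealD => //; [exact: NJ|exact: AJ].
Qed.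

Definition primeI P : Prop :=
  [/\ ideal P, ~ P 1 & forall a b, P (a * b) -> P a \/ P b].

Lemma prime_ideal P : primeI P -> ideal P. Proof. by case. Qed.

Lemma primeN P a b : primeI P -> P (a * b) -> ~ P a -> P b.
Proof. by case=> _ _ Pp /Pp []. Qed.

Lemma primeNM P a b : primeI P -> ~ P a -> ~ P b -> ~ P (a * b).
Proof. by case=> _ _ Pp nPa nPb /Pp []. Qed.

Lemma primeX P a n : primeI P -> P (a ^+ n) -> P a.
Proof.
case=> _ P1 Pp; elim: n => [|n IHn]; first by rewrite expr0.
by rewrite exprS => /Pp [].
Qed.

Lemma prime_idealr_set (P : prime_idealr R) : primeI [set` P].
Proof.
split=> /=.
- split=> [|a u v /= Pu Pv]; first exact: idealr0.
  by apply: rpredD => //; exact: ring_quotient.idealMr.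
- by rewrite idealr1.
- by move=> a b; rewrite prime_idealrM => /orP.
Qed.

Lemma idealr_set_ideal (I : idealr R) : ideal [set` I].
Proof.
split=> [|a u v /= Pu Pv]; first exact: idealr0.
by apply: rpredD => //; exact: ring_quotient.idealMr.
Qed.

(** The preimage in [R] of the extension of [N] to the localization at [Q].
    Ideals of the localization correspond to the saturated ideals of [R], so
    that local arguments can be carried out in [R]. *)
Definition sat Q N : set R := [set a | exists s, ~ Q s /\ N (s * a)].

Definition saturated Q N : Prop := forall s a, ~ Q s -> N (s * a) -> N a.

Lemma sat_ideal Q N : primeI Q -> ideal N -> ideal (sat Q N).
Proof.
move=> Qp Nid; have [_ Q1 _] := Qp; split.
  by exists 1; rewrite mulr0; split=> //; exact: ideal0.
move=> a u v [s [Qs Nsu]] [t [Qt Ntv]]; exists (s * t); split.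
  exact: primeNM.
have -> : s * t * (a * u + v) = (t * a) * (s * u) + s * (t * v) by ring.
by apply: (proj2 Nid) => //; exact: idealM.
Qed.

Lemma sat_sub Q N : primeI Q -> N `<=` sat Q N.
Proof. by move=> [_ Q1 _] a Na; exists 1; rewrite mul1r. Qed.

Lemma sat_saturated Q N : primeI Q -> saturated Q (sat Q N).
Proof.
move=> Qp s a Qs [t [Qt Nt]]; exists (t * s); split; first exact: primeNM.
by rewrite -mulrA.
Qed.

Lemma satS Q N M : N `<=` M -> sat Q N `<=` sat Q M.
Proof. by move=> NM a [s [Qs Ns]]; exists s; split=> //; exact: NM. Qed.

Lemma sat_min Q N M : saturated Q M -> N `<=` M -> sat Q N `<=` M.
Proof. by move=> Msat NM a [s [Qs Ns]]; apply: (Msat s) => //; exact: NM. Qed.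

Lemma prime_saturated P Q : primeI P -> P `<=` Q -> saturated Q P.
Proof. by move=> Pp PQ s a Qs Ps; apply: (primeN Pp Ps) => /PQ. Qed.

End IdealCalculus.

#[local] Hint Resolve setT_ideal : core.

(** * Krull's principal ideal theorem *)

Section Noetherian.
Variables (R : comNzRingType) (nR : noetherian R).
Implicit Types (I J K M N P Q : set R) (a b c g s t x : R).

Lemma noetherian_max (C : set R -> Prop) J0 : ideal J0 -> C J0 ->
  exists J, [/\ ideal J, C J & forall K, ideal K -> C K -> J `<=` K -> K `<=` J].
Proof.
move=> J0id CJ0; apply: contrapT => nmax.
pose T := {J : set R | ideal J /\ C J}.
have /choice [f fP] : forall J : T, exists K : T,
    sval J `<=` sval K /\ ~ sval K `<=` sval J.
  move=> [J [Jid CJ]]; apply: contrapT => noK; apply: nmax; exists J; split=> //.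
  move=> K Kid CK JK; apply: contrapT => nKJ.
  by apply: noK; exists (exist _ K (conj Kid CK)).
pose u n : T := iter n f (exist _ J0 (conj J0id CJ0)).
have uS n k : (n <= k)%N -> sval (u n) `<=` sval (u k).
  move=> /subnK <-; elim: (k - n)%N => [//|l IHl] a /IHl ua.
  by apply: (proj1 (fP (u (l + n)%N))).
pose U : set R := [set a | exists n, sval (u n) a].
have Uid : ideal U.
  split; first by exists 0%N; apply: ideal0; case: (svalP (u 0%N)).
  move=> a b c [n ub] [k uc]; exists (maxn n k).
  apply: (proj2 (proj1 (svalP (u (maxn n k))))).
    by apply: uS ub; rewrite leq_maxl.
  by apply: uS uc; rewrite leq_maxr.
have [n [x xU]] := nR Uid.
have /choice [h hP] : forall i : 'I_n, exists k, sval (u k) (x i).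
  move=> i; have : U (x i) by rewrite -xU; apply: ideal_gen_mem; exists i.
  by [].
have Uk : U `<=` sval (u (\max_i h i)%N).
  rewrite -xU; apply: ideal_gen_sub; first by case: (svalP (u (\max_i h i)%N)).
  by move=> _ [i _ <-]; apply: uS (hP i); exact: leq_bigmax.
apply: (proj2 (fP (u (\max_i h i)%N))) => a ua; apply: Uk.
by exists (\max_i h i).+1%N.
Qed.

(** An annihilator that is maximal among those of the nonzero elements of
    [R / N] is prime: if [b] does not kill [g], then the annihilator of [b g]
    contains that of [g], hence is equal to it. *)
Lemma exists_associated_prime N g0 : ideal N -> ~ N g0 ->
  exists2 g, ~ N g & primeI [set a | N (a * g)].
Proof.
move=> Nid Ng0.
have colid g : ideal [set a | N (a * g)].
  split=> /= [|a u v Nu Nv]; first by rewrite mul0r; exact: ideal0.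
  by rewrite mulrDl -mulrA; exact: (proj2 Nid).
have [_ [_ [g [Ng ->]] gmax]] := @noetherian_max
  (fun J => exists g, ~ N g /\ J = [set a | N (a * g)]) _ (colid g0)
  (ex_intro _ g0 (conj Ng0 erefl)).
exists g => //; split=> //=; first by rewrite mul1r.
move=> a b Nab; have [Nbg|Nbg] := pselect (N (b * g)); first by right.
left; apply: (gmax [set a | N (a * (b * g))]) => //=.
- by exists (b * g).
- by move=> c /= Ncg; rewrite mulrCA; exact: idealM.
- by rewrite mulrA.
Qed.

(** Nakayama's lemma for the localization at [Q].  If [N] is replaced by a
    maximal saturated ideal [L] not containing [M], then [M] is locally
    generated modulo [L] by any [g] in [M] outside [L]; the hypothesis
    becomes [u g = q g] modulo [L] with [u] outside and [q] inside [Q], and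
    [u - q] is locally a unit. *)
Lemma local_nakayama Q M N : primeI Q -> ideal M -> ideal N -> saturated Q N ->
  (forall a, M a -> exists t n p,
     [/\ ~ Q t, N n, ideal_mul Q M p & t * a = n + p]) ->
  M `<=` N.
Proof.
move=> Qp Mid Nid Nsat MQ; apply: contrapT => MN.
have Qid := prime_ideal Qp.
have [L [Lid [Lsat NL ML] Lmax]] := @noetherian_max
  (fun J => [/\ saturated Q J, N `<=` J & ~ M `<=` J]) N Nid
  (And3 Nsat (fun=> id) MN).
have [g Mg Lg] : exists2 g, M g & ~ L g.
  apply: contrapT => no; apply: ML => g Mg; apply: contrapT => Lg.
  by apply: no; exists g.
have Kid : ideal (sat Q (adjoin setT L g)).
  by apply: sat_ideal => //; exact: adjoin_ideal.
have MK : M `<=` sat Q (adjoin setT L g).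
  apply: contrapT => nMK; apply: Lg; apply: (Lmax _ Kid).
  - split=> //; first exact: sat_saturated.
    by move=> a /NL La; apply: sat_sub => //; exact: adjoin_sub.
  - by move=> a La; apply: sat_sub => //; exact: adjoin_sub.
  - by apply: sat_sub => //; exact: adjoin_gen.
have QMK : ideal_mul Q M `<=` sat Q (adjoin Q L g).
  apply: ideal_mul_sub => [|q a Qq /MK [s [Qs [r [l [_ Ll sa]]]]]].
    by apply: sat_ideal => //; exact: adjoin_ideal.
  exists s; split=> //; exists (q * r), (q * l); split; first exact: idealMr.
    exact: idealM.
  by rewrite mulrCA sa; ring.
have [t [n [p [Qt Nn /QMK [s [Qs [q [l [Qq Ll sp]]]]] tg]]]] := MQ g Mg.
apply: Lg; apply: (Lsat (s * t - q)).
  by move=> Qst; apply: (primeNM Qp Qs Qt); exact: (idealBr _ Qst).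
have -> : (s * t - q) * g = s * (t * g) - q * g by ring.
have -> : s * (t * g) - q * g = s * n + l by rewrite tg mulrDr sp; ring.
by apply: (proj2 Lid) => //; exact: NL.
Qed.

(** The localization at a prime [Q] that is minimal over [J0] is artinian
    modulo [J0].  Indeed, if [B] is maximal among the saturated ideals modulo
    which the chain condition fails, there is [g] with [(B : g) = Q] by
    minimality of [Q].  The condition holds modulo [B + (g)], and it descends to
    [B] because [R / Q] is locally a field: a member of the chain that does not
    contain [g] meets [B + (g)] in [B]. *)
Lemma local_dcc Q J0 (C : nat -> set R) : primeI Q -> ideal J0 ->
  (forall P, primeI P -> J0 `<=` P -> P `<=` Q -> Q `<=` P) ->
  (forall n, [/\ ideal (C n), saturated Q (C n) & J0 `<=` C n]) ->
  (forall n, C n.+1 `<=` C n) ->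
  exists n, C n `<=` C n.+1.
Proof.
move=> Qp J0id Qmin Cid Cdec.
pose dcc B := forall C : nat -> set R,
  (forall n, [/\ ideal (C n), saturated Q (C n) & B `<=` C n]) ->
  (forall n, C n.+1 `<=` C n) -> exists n, C n `<=` C n.+1.
have J0sat : ideal (sat Q J0) by exact: sat_ideal.
suff: dcc (sat Q J0).
  apply=> // n; have [? Csat JC] := Cid n; split=> //; exact: sat_min.
apply: contrapT => nJ0.
have [B [Bid [Bsat J0B Bdcc] Bmax]] := @noetherian_max
  (fun B => [/\ saturated Q B, J0 `<=` B & ~ dcc B]) _ J0sat
  (And3 (sat_saturated Qp) (@sat_sub _ _ J0 Qp) nJ0).
apply: Bdcc => {}C {}Cid {}Cdec.
have Cle n k : (n <= k)%N -> C k `<=` C n.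
  by move=> /subnK <-; elim: (k - n)%N => [//|l IHl] a /Cdec /IHl.
have [B1|B1] := pselect (B 1).
  exists 0%N => a _; have [C1id _ BC] := Cid 1%N.
  by apply: ideal_full => //; exact: BC.
have [g Bg gp] := exists_associated_prime Bid B1.
have gQ : [set a | B (a * g)] `<=` Q.
  by move=> s /= Bsg; apply: contrapT => Qs; apply: Bg; exact: (Bsat s).
have Qg : Q `<=` [set a | B (a * g)].
  by apply: Qmin => // a J0a /=; apply: idealMr => //; exact: J0B.
have adj_ideal J : ideal J -> ideal (sat Q (adjoin setT J g)).
  by move=> Jid; apply: sat_ideal => //; exact: adjoin_ideal.
have dccg : dcc (sat Q (adjoin setT B g)).
  apply: contrapT => nd; apply: Bg; apply: (Bmax (sat Q (adjoin setT B g))).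
  - exact: adj_ideal.
  - split=> //; first exact: sat_saturated.
    by move=> a /J0B Ba; apply: sat_sub => //; exact: adjoin_sub.
  - by move=> a Ba; apply: sat_sub => //; exact: adjoin_sub.
  - by apply: sat_sub => //; exact: adjoin_gen.
(* If all members contain g the chain lives over B + (g); if not, it does so
   after adding g to the members from the k-th on, none of which contains g. *)
have [Cg|] := pselect (forall n, C n g).
  apply: dccg => // n; have [Cnid Csat BC] := Cid n; split=> //.
  by apply: sat_min => //; apply: adjoin_min => // c _; exact: idealM.
move=> /existsNP [k Ckg].
have [||n Cn] := dccg (fun n => sat Q (adjoin setT (C (n + k)%N) g)).
- move=> n; have [Cnid Csat BC] := Cid (n + k)%N; split.
  + exact: adj_ideal.
  + exact: sat_saturated.
  + by apply: satS => _ [c [b [_ /BC Cb ->]]]; exists c, b.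
- by move=> n; apply: satS => _ [c [b [_ /Cdec Cb ->]]]; exists c, b.
exists (n + k)%N => a Ca.
have [C1id C1sat BC1] := Cid (n + k).+1; have [C0id C0sat BC0] := Cid (n + k)%N.
have /Cn [s [Qs [r [c [_ Cc sa]]]]] : sat Q (adjoin setT (C (n + k)%N) g) a.
  by apply: sat_sub => //; exact: adjoin_sub.
have Crg : C (n + k)%N (r * g).
  have -> : r * g = s * a - c by rewrite sa; ring.
  by apply: idealB => //; [exact: idealM|exact: Cdec].
apply: (C1sat s) => //; rewrite sa; apply: idealD => //; apply: BC1; apply: Qg.
apply: contrapT => Qr; apply: Ckg; apply: (Cle k (n + k)%N); first exact: leq_addl.
exact: (C0sat r).
Qed.

(** The symbolic powers of [P / P0] in [R / P0], pulled back to [R].  Saturating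
    at each step of the recursion gives the same ideals as saturating the
    ordinary powers. *)
Fixpoint symbolic_power P0 P n : set R :=
  if n is n'.+1 then
    sat P [set a + b | a in ideal_mul P (symbolic_power P0 P n') & b in P0]
  else setT.

Section SymbolicPowers.
Variables (P0 P : set R).
Hypotheses (P0p : primeI P0) (Pp : primeI P) (P0P : P0 `<=` P).
Local Notation S := (symbolic_power P0 P).

Lemma symbolic_power_ideal n : ideal (S n).
Proof.
elim: n => [//|n IHn] /=; apply: sat_ideal => //; split.
  exists 0; first by apply: ideal0; exact: ideal_mul_ideal.
  by exists 0; [apply: ideal0; exact: prime_ideal|rewrite addr0].
move=> a _ _ [u Su [b Pb <-]] [v Sv [c Pc <-]].
exists (a * u + v); first exact: (proj2 (ideal_mul_ideal _ _)).
exists (a * b + c); first exact: (proj2 (prime_ideal P0p)).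
by ring.
Qed.

Lemma symbolic_power_saturated n : saturated P (S n).
Proof. by case: n => [//|n]; exact: sat_saturated. Qed.

Lemma symbolic_power_ge n : P0 `<=` S n.
Proof.
case: n => [//|n] b Pb; apply: sat_sub => //.
exists 0; first by apply: ideal0; exact: ideal_mul_ideal.
by exists b => //; rewrite add0r.
Qed.

Lemma symbolic_power_dec n : S n.+1 `<=` S n.
Proof.
apply: sat_min; first exact: symbolic_power_saturated.
move=> _ [a PSa [b Pb <-]]; apply: idealD; first exact: symbolic_power_ideal.
  move: a PSa; apply: ideal_mul_sub; first exact: symbolic_power_ideal.
  by move=> p c _; exact: idealM (symbolic_power_ideal _).
exact: symbolic_power_ge.
Qed.

Lemma symbolic_powerX a n : P a -> S n (a ^+ n).
Proof.
move=> Pa; elim: n => [//|n IHn]; apply: sat_sub => //.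
exists (a ^+ n.+1); first by rewrite exprS; exact: ideal_mul_mem.
by exists 0; [apply: ideal0; exact: prime_ideal|rewrite addr0].
Qed.

(** If the symbolic powers become stationary, then locally at [P] Nakayama's
    lemma makes them vanish in the domain [R / P0]. *)
Lemma symbolic_power_stationary n : S n `<=` S n.+1 -> P `<=` P0.
Proof.
move=> Sn a Pa; apply: (primeX (n := n) P0p).
suff: S n `<=` P0 by apply; exact: symbolic_powerX.
apply: (local_nakayama Pp).
- exact: symbolic_power_ideal.
- exact: prime_ideal.
- exact: prime_saturated.
- move=> c /Sn [s [Ps [p Sp [b P0b sc]]]].
  by exists s, b, p; split=> //; rewrite -sc addrC.
Qed.

End SymbolicPowers.

(** Krull's principal ideal theorem, in the form in which it is used to modify
    chains.  If [Q] were minimal over [P0 + (x)], the chain condition at [Q] would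
    make the symbolic powers of [P] stationary modulo [x].  As [x] is not in [P],
    the next power would contain the given one up to [x] times it, and two
    applications of Nakayama's lemma, at [Q] and at [P], would give [P = P0]. *)
Theorem krull_principal_ideal P0 P Q x :
  primeI P0 -> primeI P -> primeI Q -> P0 `<` P -> P `<` Q -> Q x ->
  exists Q', [/\ primeI Q', P0 `<` Q', Q' `<` Q & Q' x].
Proof.
move=> P0p Pp Qp [P0P nPP0] [PQ nQP] Qx.
have [Px|Px] := pselect (P x); first by exists P.
apply: contrapT => noQ'; apply: nPP0.
have Qid := prime_ideal Qp; have P0id := prime_ideal P0p.
pose S := symbolic_power P0 P.
have Sid n : ideal (S n) by exact: symbolic_power_ideal.
have S0 n : P0 `<=` S n by exact: symbolic_power_ge.
have Ssat n : saturated P (S n) by exact: symbolic_power_saturated.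
have Sdec n : S n.+1 `<=` S n by exact: symbolic_power_dec.
have [||||n Sn] := @local_dcc Q (adjoin setT P0 x)
  (fun n => sat Q (adjoin setT (S n) x)) Qp.
- exact: adjoin_ideal.
- move=> P' P'p JP' P'Q; apply: contrapT => nQP'; apply: noQ'.
  have P'x : P' x by apply: JP'; exact: adjoin_gen.
  exists P'; split=> //; split; first by move=> a P0a; apply: JP'; exact: adjoin_sub.
  by move=> P'P0; apply: Px; apply: P0P; exact: P'P0.
- move=> n; split; first by apply: sat_ideal => //; exact: adjoin_ideal.
  + exact: sat_saturated.
  + by move=> _ [c [b [_ /S0 Sb ->]]]; apply: sat_sub => //; exists c, b.
- by move=> n; apply: satS => _ [c [b [_ /Sdec Sb ->]]]; exists c, b.
apply: (@symbolic_power_stationary P0 P P0p Pp P0P n).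
apply: (local_nakayama Qp) => //.
- by move=> s a Qs; apply: (Ssat n.+1); apply: contra_not Qs; exact: PQ.
- move=> a Sa.
  have /Sn [t [Qt [r [b [_ Sb ta]]]]] : sat Q (adjoin setT (S n) x) a.
    by apply: sat_sub => //; exact: adjoin_sub.
  exists t, b, (r * x); split=> //; rewrite mulrC; apply: ideal_mul_mem => //.
  apply: (Ssat n x) => //.
  have -> : x * r = t * a - b by rewrite ta; ring.
  by apply: idealB => //; [exact: idealM|exact: Sdec].
Qed.

End Noetherian.

(** * Generators of the maximal ideal form a regular sequence *)

Section LocalRing.
Variables (R : comNzRingType) (nR : noetherian R) (m : set R).
Hypothesis lR : local_ring m.
Implicit Types (I J K M N P Q A B C : set R) (a b c g s t x : R) (y : nat -> R).

Lemma local_ideal : ideal m. Proof. by case: lR => [[]]. Qed.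

Lemma local_sub J : ideal J -> ~ J 1 -> J `<=` m.
Proof.
move=> Jid J1.
have [M [Mid [M1 JM] Mmax]] := @noetherian_max R nR
  (fun K => ~ K 1 /\ J `<=` K) J Jid (conj J1 (fun=> id)).
rewrite -(lR.2 M) //; split=> // K Kid K1 MK; rewrite eqEsubset; split=> //.
by apply: Mmax => //; split=> // a /JM /MK.
Qed.

Lemma local_unit a : ~ m a -> exists b, b * a = 1.
Proof.
move=> ma; apply: contrapT => nob; apply: ma.
have zid : ideal [set 0 : R].
  by split=> [//|b _ _ -> ->]; rewrite mulr0 addr0.
apply: (@local_sub (adjoin setT [set 0] a)); first exact: adjoin_ideal.
  by move=> [b [_ [_ -> e1]]]; apply: nob; exists b; rewrite e1 add0r.
exact: adjoin_gen.
Qed.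

Lemma local_prime : primeI m.
Proof.
have [[mid m1 _] _] := lR; split=> // a b mab.
have [|/local_unit [c ca1]] := pselect (m a); first by left.
by right; rewrite -[b]mul1r -ca1 -mulrA; exact: idealM.
Qed.

Lemma local_saturated N : ideal N -> saturated m N.
Proof.
move=> Nid s a /local_unit [t ts1] Nsa.
by rewrite -[a]mul1r -ts1 -mulrA; exact: idealM.
Qed.

(** Only the two ends of a chain are recorded, since its inner terms get
    replaced. *)
Fixpoint chain n A B : Prop :=
  if n is n'.+1 then exists C, [/\ chain n' A C, primeI B & C `<` B]
  else primeI B /\ A = B.

Lemma chain_last n A B : chain n A B -> primeI B.
Proof. by case: n => [[]|n [C []]]. Qed.

Lemma chain_first n A B : chain n A B -> primeI A.
Proof. by elim: n B => [B [Bp ->]|n IHn B [C [/IHn]]]. Qed.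

(** The principal ideal theorem, applied to three consecutive terms, moves [x]
    from one term of a chain to the preceding one; repeating this brings it down
    to the second term. *)
Lemma chain_through n A B x : chain n.+1 A B -> B x ->
  exists C, [/\ primeI A, A `<` C, C x & chain n C B].
Proof.
elim: n B => [|n IHn] B.
  by move=> [C [[Cp ->] Bp CB]] Bx; exists B.
move=> [C [AC Bp CB]] Bx; have [D [AD Cp DC]] := AC.
have [Q [Qp DQ QB Qx]] :=
  krull_principal_ideal nR (chain_last AD) Cp Bp DC CB Bx.
have [||E [Ap AE Ex EQ]] := IHn Q => //; first by exists D.
by exists E; split=> //; exists Q.
Qed.

Lemma chain_to_max d : krull_dim R d -> exists A, chain d A m.
Proof.
move=> [[P Pinc] _].
have Plt i : (i < d)%N -> [set` P (inord i)] `<` [set` P (inord i.+1)].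
  by move=> lid; apply: Pinc; rewrite !inordK // ltnS ltnW.
have Pchain i : (i <= d)%N -> chain i [set` P (inord 0)] [set` P (inord i)].
  elim: i => [_|i IHi lid] /=.
    by split=> //; exact: prime_idealr_set.
  exists [set` P (inord i)]; split; first by apply: IHi; exact: ltnW.
    exact: prime_idealr_set.
  exact: Plt.
case: d P Pinc Plt Pchain => [|d] P Pinc Plt Pchain.
  by exists m; split=> //; exact: local_prime.
have [C [AC Bp CB]] := Pchain d.+1 (leqnn _).
exists [set` P (inord 0)], C; split=> //; first exact: local_prime.
have Bm : [set` P (inord d.+1)] `<=` m.
  by case: (Bp) => Bid B1 _; exact: local_sub.
split; first by move=> a /(proj1 CB) /Bm.
by move=> mC; apply: (proj2 CB) => a /Bm /mC.
Qed.

(** Recursion on [i] makes the passage from [i] to [i + 1] the adjunction of one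
    element, which is what all inductions on regular sequences use. *)
Fixpoint init_gen y i : set R :=
  if i is i'.+1 then adjoin setT (init_gen y i') (y i') else [set 0].

Lemma init_gen_ideal y i : ideal (init_gen y i).
Proof.
elim: i => [|i IHi] /=; last exact: adjoin_ideal.
by split=> [//|b _ _ -> ->]; rewrite mulr0 addr0.
Qed.

Lemma init_gen_le y i j : (i <= j)%N -> init_gen y i `<=` init_gen y j.
Proof.
move=> /subnK <-; elim: (j - i)%N => [//|l IHl] a /IHl ya.
exact: adjoin_sub.
Qed.

Lemma init_gen_mem y i j : (j < i)%N -> init_gen y i (y j).
Proof.
by move=> lji; apply: (init_gen_le lji); apply: adjoin_gen; exact: init_gen_ideal.
Qed.

Lemma init_gen_min y i J : ideal J -> (forall j, (j < i)%N -> J (y j)) ->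
  init_gen y i `<=` J.
Proof.
move=> Jid; elim: i => [|i IHi] Jy /=.
  by move=> _ ->; exact: ideal0.
apply: adjoin_min => //; first by apply: IHi => j lji; apply: Jy; exact: ltnW.
by move=> c _; apply: idealM => //; exact: Jy.
Qed.

(** Pushing the [y_i] down the chain one after the other gives a chain of primes
    whose [i]-th term contains [init_gen y i].  Starting from the top, equality
    holds: if the next term is [init_gen y i.+1], then [A] is contained in
    [init_gen y i + y_i A] because [y_i] is not in the prime [A], and Nakayama's
    lemma applies. *)
Lemma chain_init_gen y d n i A : init_gen y d = m -> (i + n = d)%N -> chain n A m ->
  init_gen y i `<=` A ->
  A `<=` init_gen y i /\
  forall j, (i <= j < d)%N -> primeI (init_gen y j) /\ ~ init_gen y j (y j).
Proof.
move=> ym; elim: n i A => [|n IHn] i A ind.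
  rewrite addn0 in ind; rewrite ind ym => -[_ ->] _; split=> // j.
  by case: ltngtP.
move=> Achain iA.
have lid : (i < d)%N by rewrite -ind addnS ltnS leq_addr.
have my : m (y i) by rewrite -ym; exact: init_gen_mem.
have [C [Ap AC Cy Cchain]] := chain_through Achain my.
have iC : init_gen y i.+1 `<=` C.
  apply: init_gen_min => [|j]; first by case: (chain_first Cchain).
  rewrite ltnS leq_eqVlt => /orP[/eqP -> //|lji].
  by apply: (proj1 AC); apply: iA; exact: init_gen_mem.
have [|Ci jP] := IHn i.+1 C _ Cchain iC; first by rewrite addSnnS.
have Ay : ~ A (y i).
  move=> Ayi; apply: (proj2 AC) => a /Ci; apply: init_gen_min => [|j].
    exact: prime_ideal.
  rewrite ltnS leq_eqVlt => /orP[/eqP -> //|lji].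
  by apply: iA; exact: init_gen_mem.
have Ai : A `<=` init_gen y i.
  apply: (local_nakayama nR local_prime).
  - exact: prime_ideal.
  - exact: init_gen_ideal.
  - by apply: local_saturated; exact: init_gen_ideal.
  - move=> a Aa; have /Ci [c [b [_ ib ab]]] := proj1 AC a Aa.
    exists 1, b, (y i * c); split=> //; last by rewrite ab; ring.
      by case: local_prime.
    apply: ideal_mul_mem => //; apply: (primeN Ap _ Ay).
    have -> : y i * c = a - b by rewrite ab; ring.
    by apply: idealB (iA _ ib) => //; exact: prime_ideal.
split=> // j /andP[]; rewrite leq_eqVlt => /orP[/eqP <- _|lij ljd]; last first.
  by apply: jP; rewrite lij.
have <- : A = init_gen y i by rewrite eqEsubset; split.
by [].
Qed.

(** In particular, [y_i] is not a zero divisor modulo [init_gen y i]; for [i = 0] this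
    contains the fact that a regular local ring is a domain. *)
Theorem regular_init_gen_prime y d i : krull_dim R d -> init_gen y d = m -> (i < d)%N ->
  primeI (init_gen y i) /\ ~ init_gen y i (y i).
Proof.
move=> /chain_to_max [A Achain] ym lid.
have [//|_ jP] := @chain_init_gen y d d 0 A ym (add0n d) Achain; last exact: jP.
by move=> _ ->; apply: ideal0; apply: prime_ideal; exact: chain_first Achain.
Qed.

End LocalRing.

(** * Submodules of free modules defined by ideals *)

Section IdealTimesFree.
Variable R : comNzRingType.
Implicit Types (J N E : set R) (V W : vectType R).

(** The submodule [J V] of a free module.  Described by coordinates, it inherits
    at once what is known about [J], such as the cancellation of elements that
    are regular modulo [J]. *)
Definition mul_free J V : set V := [set v | forall j, J (v2r v 0 j)].
Arguments mul_free : clear implicits.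

Lemma mul_free0 J V : ideal J -> mul_free J V 0.
Proof. by move=> Jid j; rewrite linear0 mxE; exact: ideal0. Qed.

Lemma mul_freeP J V a (u v : V) : ideal J ->
  mul_free J V u -> mul_free J V v -> mul_free J V (a *: u + v).
Proof. by move=> Jid Ju Jv j; rewrite linearP !mxE; exact: (proj2 Jid). Qed.

Lemma mul_freeD J V (u v : V) : ideal J ->
  mul_free J V u -> mul_free J V v -> mul_free J V (u + v).
Proof. by move=> Jid Ju Jv; rewrite -[u]scale1r; exact: mul_freeP. Qed.

Lemma mul_freeZ J V a (v : V) : ideal J ->
  mul_free J V v -> mul_free J V (a *: v).
Proof.
move=> Jid Jv; rewrite -[a *: v]addr0.
by apply: mul_freeP => //; exact: mul_free0.
Qed.

Lemma mul_freeN J V (v : V) : ideal J -> mul_free J V v -> mul_free J V (- v).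
Proof. by move=> Jid Jv; rewrite -scaleN1r; exact: mul_freeZ. Qed.

Lemma mul_freeB J V (u v : V) : ideal J ->
  mul_free J V u -> mul_free J V v -> mul_free J V (u - v).
Proof. by move=> Jid Ju Jv; apply: mul_freeD => //; exact: mul_freeN. Qed.

Lemma mul_freeZl J V a (v : V) : ideal J -> J a -> mul_free J V (a *: v).
Proof. by move=> Jid Ja j; rewrite linearZ mxE; exact: idealMr. Qed.

Lemma mul_freeS J N V : J `<=` N -> mul_free J V `<=` mul_free N V.
Proof. by move=> JN v Jv j; exact: JN. Qed.

Lemma mul_free_lfun J V W (f : 'Hom(V, W)) v : ideal J ->
  mul_free J V v -> mul_free J W (f v).
Proof.
move=> Jid Jv j; rewrite v2r_lfun mxE; apply: ideal_sum => // i.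
exact: idealMr.
Qed.

Lemma mul_free_set0 V (v : V) : mul_free [set 0] V v -> v = 0.
Proof.
move=> v0; apply: v2r_inj; rewrite linear0; apply/rowP => j.
by rewrite mxE; exact: v0.
Qed.

Lemma mul_free_adjoin A N g V (v : V) : mul_free (adjoin A N g) V v ->
  exists u w, [/\ mul_free N V u, mul_free A V w & v = u + g *: w].
Proof.
move=> Av.
have /choice [h hP] : forall j, exists p : R * R,
    [/\ A p.1, N p.2 & v2r v 0 j = p.2 + p.1 * g].
  by move=> j; have [c [n [Ac Nn e]]] := Av j; exists (c, n).
exists (r2v (\row_j (h j).2)), (r2v (\row_j (h j).1)); split.
- by move=> j; rewrite r2vK mxE; case: (hP j).
- by move=> j; rewrite r2vK mxE; case: (hP j).
- apply: v2r_inj; rewrite linearD linearZ /= !r2vK; apply/rowP => j.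
  by rewrite !mxE [g * _]mulrC; case: (hP j).
Qed.

Lemma mul_free_adjoinI A N g V (u w : V) : mul_free N V u -> mul_free A V w ->
  mul_free (adjoin A N g) V (u + g *: w).
Proof.
move=> Nu Aw j; exists (v2r w 0 j), (v2r u 0 j); split=> //.
by rewrite linearD linearZ !mxE [g * _]mulrC.
Qed.

Lemma mul_free_cancel J V g (v : V) : (forall a, J (a * g) -> J a) ->
  mul_free J V (g *: v) -> mul_free J V v.
Proof.
by move=> Jg Jv j; apply: Jg; have := Jv j; rewrite linearZ mxE mulrC.
Qed.

Lemma ideal_smul_free J V : ideal J -> ideal_smul J `<=` mul_free J V.
Proof.
move=> Jid v [n [a [w [Ja ->]]]].
elim/big_ind: _ => [|u u'|i _]; first exact: mul_free0.
  exact: mul_freeD.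
exact: mul_freeZl.
Qed.

Lemma I1_ideal V W (f : 'Hom(V, W)) : ideal (I1 f).
Proof. exact: ideal_gen_ideal. Qed.

Lemma I1_mul_free V W (f : 'Hom(V, W)) v : mul_free (I1 f) W (f v).
Proof.
move=> j; rewrite v2r_lfun mxE; apply: ideal_sum => [|i]; first exact: I1_ideal.
apply: (idealM _ (I1_ideal f)).
by apply: ideal_gen_mem; exists i => //; exists j.
Qed.

Lemma I1_sub V W (f : 'Hom(V, W)) J : ideal J ->
  (forall v, mul_free J W (f v)) -> I1 f `<=` J.
Proof.
move=> Jid Jf; apply: ideal_gen_sub => // _ [i _ [j _ <-]].
have := Jf (r2v (delta_mx 0 i)) j.
by rewrite v2r_lfun r2vK -rowE mxE.
Qed.

End IdealTimesFree.
Arguments mul_free {R} J V.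

(** * Homology of the resolution modulo a regular sequence *)

(** The resolution has length [d + 1], so [phi d] is its last differential, and
    [y_0, ..., y_d] is a regular sequence. *)
Section Resolution.
Variables (R : comNzRingType) (m : set R) (I : idealr R) (d : nat).
Variables (F : nat -> vectType R) (phi : forall i, 'Hom(F i.+1, F i)).
Variable eps : {linear F 0%N -> {ideal_quot I} | \pi_{ideal_quot I} \; *%R}.
Hypothesis mid : ideal m.
Hypothesis resF : minimal_free_resolution m d.+1 phi eps.
Variable y : nat -> R.
Hypothesis y_regular : forall i a, (i <= d)%N -> init_gen y i (a * y i) -> init_gen y i a.

Implicit Types (a b c : R).

(** The module following [F d.+1] in the resolution is zero. *)
Definition boundary n (v : F n) : Prop :=
  if (n < d.+1)%N then exists w, v = phi n w else v = 0.

Lemma boundaryE n v : (n <= d)%N -> boundary v <-> exists w, v = phi n w.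
Proof. by rewrite /boundary ltnS => ->. Qed.

Lemma boundary_kernel n (v : F n.+1) : (n <= d)%N -> phi n v = 0 -> boundary v.
Proof.
case: resF => _ _ exF injF _; rewrite leq_eqVlt /boundary => /orP[/eqP nd|nd].
  have -> : (n.+1 < d.+1)%N = false by rewrite nd ltnn.
  have injn : injective (phi n) by rewrite nd.
  by move=> v0; apply: injn; rewrite v0 linear0.
by rewrite ltnS nd => v0; apply/exF.
Qed.

Lemma phi_phi n (w : F n.+2) : (n < d)%N -> phi n (phi n.+1 w) = 0.
Proof.
by case: resF => _ _ exF _ _ nd; apply/(exF n); [rewrite ltnS|exists w].
Qed.

Lemma phi_boundary n (v : F n.+1) : (n <= d)%N -> boundary v -> phi n v = 0.
Proof.
rewrite leq_eqVlt /boundary => /orP[/eqP nd|nd]; last first.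
  by rewrite ltnS nd => -[w ->]; exact: phi_phi.
have -> : (n.+1 < d.+1)%N = false by rewrite nd ltnn.
by move=> ->; rewrite linear0.
Qed.

Local Notation J := (init_gen y).

(** Vanishing of the homology of [F / J_i F] in degree [n + 1 > i].  Multiplication
    by [y_i] gives an exact sequence of complexes
    [0 -> F / J_i F -> F / J_i F -> F / J_(i+1) F -> 0], in whose long exact
    sequence the homology of [F / J_(i+1) F] in degree [n + 1] lies between those
    of [F / J_i F] in degrees [n + 1] and [n]. *)
Lemma tor_vanishing i n (z : F n.+1) : (i <= n)%N -> (n <= d)%N ->
  mul_free (J i) (F n) (phi n z) ->
  exists2 t, boundary t & mul_free (J i) (F n.+1) (z - t).
Proof.
elim: i n z => [|i IHi] n z.
  move=> _ nd /mul_free_set0 /(boundary_kernel nd) zb.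
  by exists z; rewrite // subrr; apply: mul_free0; exact: init_gen_ideal.
case: n z => [//|n] z lin nd /mul_free_adjoin [u [w [Ju _ zE]]].
have Jid k : ideal (J k) by exact: init_gen_ideal.
have nd' : (n <= d)%N by exact: ltnW.
have lin' : (i <= n.+1)%N by exact: ltnW.
have Jw : mul_free (J i) (F n) (phi n w).
  apply: (@mul_free_cancel _ _ _ (y i)) => [a|].
    by apply: y_regular; exact: leq_trans nd'.
  have -> : y i *: phi n w = phi n (phi n.+1 z) - phi n u.
    by rewrite zE linearD linearZ addrC addKr.
  by rewrite phi_phi // sub0r; apply: mul_freeN => //; exact: mul_free_lfun.
have [t /(boundaryE _ nd) [s ->] Js] := IHi n w lin nd' Jw.
have [|t' bt' Jt'] := IHi n.+1 (z - y i *: s) lin' nd.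
  have -> : phi n.+1 (z - y i *: s) = y i *: (w - phi n.+1 s) + u.
    by rewrite linearB linearZ /= zE scalerBr [RHS]addrC addrA.
  exact: mul_freeP.
exists t' => //.
have -> : z - t' = y i *: s + (z - y i *: s - t').
  by rewrite addrA [_ + (z - _)]addrC subrK.
apply: mul_freeD => //; first by apply: mul_freeZl => //; exact: init_gen_mem.
by apply: mul_freeS Jt'; exact: init_gen_le.
Qed.

(** The isomorphism of [H_i(F / J_i F)] with [(I : J_i) / I], as a relation
    between representatives.  The connecting homomorphism of the exact sequence
    above sends the class of [z] to that of the [w] with [phi z = y_i w] modulo
    [J_i]; by the vanishing of homology it identifies [H_(i+1)(F / J_(i+1) F)]
    with the kernel of [y_i] on [H_i(F / J_i F)]. *)
Fixpoint koszul_rel i : F i -> R -> Prop :=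
  match i return F i -> R -> Prop with
  | 0 => fun z b => eps z = \pi_{ideal_quot I} b
  | i'.+1 => fun z b => exists2 w : F i', koszul_rel w b &
      mul_free (J i') (F i') (phi i' z - y i' *: w)
  end.

Lemma quot0P b : \pi_{ideal_quot I} b = 0 <-> b \in I.
Proof.
rewrite -[b]subr0 Quotient.idealrBE -(rmorph0 \pi_{ideal_quot I}) subr0.
by split=> [->|/eqP].
Qed.

Lemma koszul_relP i a (z z' : F i) b b' :
  koszul_rel z b -> koszul_rel z' b' -> koszul_rel (a *: z + z') (a * b + b').
Proof.
elim: i z z' => [|i IHi] z z' /=.
  by move=> zb zb'; rewrite linearP /= zb zb' rmorphD rmorphM.
move=> [w wb Jw] [w' wb' Jw']; exists (a *: w + w'); first exact: IHi.
have -> : phi i (a *: z + z') - y i *: (a *: w + w') =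
    a *: (phi i z - y i *: w) + (phi i z' - y i *: w').
  by rewrite linearP scalerDr scalerBr opprD addrACA !scalerA [y i * a]mulrC.
by apply: mul_freeP => //; exact: init_gen_ideal.
Qed.

Lemma koszul_relZ i a (z : F i) b : koszul_rel z b -> koszul_rel (a *: z) (a * b).
Proof.
move=> zb; rewrite -[a *: z]addr0 -[a * b]addr0; apply: koszul_relP => //.
elim: i {z zb} => [|i IHi] /=; first by rewrite linear0 rmorph0.
by exists 0 => //; rewrite linear0 scaler0 subrr; apply: mul_free0; exact: init_gen_ideal.
Qed.

Definition koszul_cycle i : F i -> Prop :=
  match i return F i -> Prop with
  | 0 => fun=> True
  | i'.+1 => fun z => mul_free (J i'.+1) (F i') (phi i' z)
  end.

Lemma koszul_rel_cycle i (z : F i) b : koszul_rel z b -> koszul_cycle z.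
Proof.
case: i z => [//|i] z [w _ Jw]; rewrite /koszul_cycle -[phi i z](subrK (y i *: w)).
apply: mul_freeD; first exact: init_gen_ideal.
  by apply: mul_freeS Jw; exact: init_gen_le.
by apply: mul_freeZl; [exact: init_gen_ideal|exact: init_gen_mem].
Qed.

(** The relation is well defined and injective on homology classes. *)
Lemma koszul_rel_boundary i (z : F i) b : (i <= d.+1)%N -> koszul_rel z b ->
  b \in I <-> exists2 t, boundary t & mul_free (J i) (F i) (z - t).
Proof.
have Jid k : ideal (J k) by exact: init_gen_ideal.
elim: i z => [|i IHi] z lid.
  have [_ exE _ _ _] := resF.
  move=> /= zb; rewrite -quot0P -zb exE.
  split=> [[w ->]|[_ [w ->] /mul_free_set0 zw]].
    by exists (phi 0%N w); [exists w|rewrite subrr; exact: mul_free0 (Jid 0%N)].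
  by exists w; apply/eqP; rewrite -subr_eq0; apply/eqP.
move=> [w wb Jw]; have lid' : (i <= d)%N by [].
split.
  move=> /(IHi w (ltnW lid) wb) [_ /(boundaryE _ lid') [s ->] Js].
  have [|t bt Jt] := @tor_vanishing i i (z - y i *: s) (leqnn _) lid'.
    have -> : phi i (z - y i *: s) =
        y i *: (w - phi i s) + (phi i z - y i *: w).
      by rewrite linearB linearZ /= scalerBr [RHS]addrC addrA subrK.
    exact: mul_freeP.
  exists t => //.
  have -> : z - t = y i *: s + (z - y i *: s - t).
    by rewrite addrA [_ + (z - _)]addrC subrK.
  apply: mul_freeD => //; first by apply: mul_freeZl => //; exact: init_gen_mem.
  by apply: mul_freeS Jt; exact: init_gen_le.
move=> [t bt /mul_free_adjoin [u [v [Ju _ zE]]]].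
apply/(IHi w (ltnW lid) wb); exists (phi i v).
  by apply/boundaryE => //; exists v.
apply: (@mul_free_cancel _ _ _ (y i)) => [a|]; first exact: y_regular.
have phz : phi i z = phi i u + y i *: phi i v.
  rewrite -[z](subrK t) zE linearD /= (phi_boundary lid' bt) addr0.
  by rewrite linearD linearZ.
have -> : y i *: (w - phi i v) = phi i u - (phi i z - y i *: w).
  by rewrite phz scalerBr opprB addrCA opprD addNKr.
by apply: mul_freeB => //; exact: mul_free_lfun.
Qed.

(** As [y_i w] is a boundary modulo [J_i], its representative [y_i b] is in [I];
    the other generators of [J_(i+1)] are dealt with by induction. *)
Lemma koszul_rel_colon i (z : F i) b : (i <= d.+1)%N -> koszul_rel z b ->
  ideal_colon [set` I] (J i) b.
Proof.
have Iid := idealr_set_ideal I.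
elim: i z => [|i IHi] z lid zb.
  by move=> _ /= ->; rewrite mulr0; exact: idealr0.
have [w wb Jw] := zb.
have Ib : b * y i \in I.
  rewrite mulrC; apply/(koszul_rel_boundary (ltnW lid) (koszul_relZ (y i) wb)).
  exists (phi i z); first by apply/boundaryE => //; exists z.
  by rewrite -opprB; apply: mul_freeN => //; exact: init_gen_ideal.
apply: init_gen_min => [|j].
  split=> [|a u v Iu Iv /=]; first by rewrite mulr0; exact: ideal0.
  by rewrite mulrDr mulrCA; apply: (proj2 Iid).
rewrite ltnS leq_eqVlt => /orP[/eqP -> //|lji].
by apply: IHi wb _ _; [exact: ltnW|exact: init_gen_mem].
Qed.

Lemma koszul_rel_surj i b : (i <= d.+1)%N -> ideal_colon [set` I] (J i) b ->
  exists z : F i, koszul_rel z b.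
Proof.
elim: i => [|i IHi] lid Ib.
  by have [epsP _ _ _ _] := resF; exact: epsP.
have [|w wb] := IHi (ltnW lid).
  by move=> c Jc; apply: Ib; apply: init_gen_le Jc.
have : y i * b \in I by rewrite mulrC; apply: Ib; exact: init_gen_mem.
move=> /(koszul_rel_boundary (ltnW lid) (koszul_relZ (y i) wb)).
move=> [_ /(boundaryE _ lid) [z ->] Jz]; exists z; exists w => //.
by rewrite -opprB; apply: mul_freeN => //; exact: init_gen_ideal.
Qed.

Lemma koszul_cycle_rel i (z : F i) : (i <= d.+1)%N -> koszul_cycle z ->
  exists b, koszul_rel z b.
Proof.
elim: i z => [|i IHi] z lid /=.
  by move=> _; exists (repr (eps z)); rewrite reprK.
move=> /mul_free_adjoin [u [w [Ju _ zE]]].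
have [|b wb] := IHi w (ltnW lid).
- case: i IHi z lid u w Ju zE => [//|i] IHi z lid u w Ju zE.
  apply: (@mul_free_cancel _ _ _ (y i.+1)) => [a|]; first exact: y_regular.
  have -> : y i.+1 *: phi i w = phi i (phi i.+1 z) - phi i u.
    by rewrite zE linearD linearZ addrC addKr.
  rewrite phi_phi // sub0r; apply: mul_freeN; first exact: init_gen_ideal.
  by apply: mul_free_lfun => //; exact: init_gen_ideal.
- by exists b; exists w => //; rewrite zE addrK.
Qed.

Local Notation v := (y d).

Lemma regular_expr n a : J d (a * v ^+ n) -> J d a.
Proof.
elim: n => [|n IHn]; first by rewrite expr0 mulr1.
by rewrite exprSr mulrA => /y_regular /IHn; apply.
Qed.

(** Let [a] correspond to [f] in the last module and to [w] one step before, so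
    that [phi d f = v w] modulo [J_d].  If [phi d f] is divisible by [v ^ (n + 1)]
    modulo [J_d], then [w = v ^ n z]; regularity of [v] makes [z] a cycle, and
    [b] is the element of [(I : J_d)] that corresponds to [z]. *)
Lemma colon_factor n a :
  (forall f, mul_free (adjoin setT (J d) (v ^+ n.+1)) (F d) (phi d f)) ->
  ideal_colon [set` I] (J d.+1) a ->
  exists2 b, ideal_colon [set` I] (J d) b & a - v ^+ n * b \in I.
Proof.
move=> phiE /(koszul_rel_surj (leqnn _)) [f [w wa Jw]].
have Jid k : ideal (J k) by exact: init_gen_ideal.
have [u [z [Ju _ fE]]] := mul_free_adjoin (phiE f).
have Jwz : mul_free (J d) (F d) (w - v ^+ n *: z).
  apply: (@mul_free_cancel _ _ _ v) => [c|]; first exact: y_regular.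
  have -> : v *: (w - v ^+ n *: z) = u - (phi d f - v *: w).
    by rewrite fE scalerBr scalerA -exprS opprB addrCA opprD addNKr.
  exact: mul_freeB.
have zcycle : koszul_cycle z.
  have wcycle := koszul_rel_cycle wa.
  have := @regular_expr n.
  move: wcycle Jwz; rewrite /koszul_cycle.
  move: (d) w z {wa Jw fE} => [//|k] w z wcycle Jwz reg.
  apply: (@mul_free_cancel _ _ _ (y k.+1 ^+ n)) => [c|]; first exact: reg.
  have -> : y k.+1 ^+ n *: phi k z = phi k w - phi k (w - y k.+1 ^+ n *: z).
    by rewrite linearB linearZ /= subKr.
  by apply: mul_freeB => //; exact: mul_free_lfun.
have [b zb] := koszul_cycle_rel (leqnSn _) zcycle.
exists b; first exact: koszul_rel_colon zb.
have : koszul_rel (- v ^+ n *: z + w) (- v ^+ n * b + a) by exact: koszul_relP.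
rewrite scaleNr mulNr ![- _ + _]addrC => /(koszul_rel_boundary (leqnSn _)) ->.
exists 0; last by rewrite subr0.
by rewrite /boundary ltnSn; exists 0; rewrite linear0.
Qed.

Lemma phi_minimal i f : (i <= d)%N -> mul_free m (F i) (phi i f).
Proof.
case: resF => _ _ _ _ + lid => /(_ i lid) sub.
by apply: ideal_smul_free => //; apply: sub; exists f.
Qed.

(** Read backwards: if [a = v b] modulo [I], then [w] differs from [v z] by a
    boundary modulo [J_d], and boundaries have coefficients in [m] because the
    resolution is minimal.  Minimality is also what makes every [f] a cycle modulo
    [m]. *)
Lemma colon_factor_converse : J d.+1 = m ->
  (forall a, ideal_colon [set` I] m a ->
     exists2 b, ideal_colon [set` I] (J d) b & a - v * b \in I) ->
  forall f, mul_free (adjoin m (J d) v) (F d) (phi d f).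
Proof.
move=> Jm factor f.
have Jid k : ideal (J k) by exact: init_gen_ideal.
have [|a fa] := @koszul_cycle_rel d.+1 f (leqnn _).
  by rewrite /koszul_cycle Jm; exact: phi_minimal.
have [b Ib Iab] : exists2 b, ideal_colon [set` I] (J d) b & a - v * b \in I.
  by apply: factor; rewrite -Jm; exact: koszul_rel_colon fa.
have [w wa Jw] := fa.
have [z zb] := koszul_rel_surj (leqnSn _) Ib.
have wz : koszul_rel (- v *: z + w) (- v * b + a) by exact: koszul_relP.
move: wz Iab; rewrite scaleNr mulNr ![- _ + _]addrC.
move=> /(koszul_rel_boundary (leqnSn _)) ->.
move=> [_ /(boundaryE _ (leqnn _)) [s ->] Js].
have -> : phi d f = ((phi d f - v *: w) + v *: (w - v *: z - phi d s))
    + v *: (v *: z + phi d s).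
  by rewrite -addrA -scalerDr -[_ - _ - phi d s]addrA -opprD subrK subrK.
apply: mul_free_adjoinI; first by apply: mul_freeD => //; exact: mul_freeZ.
apply: mul_freeD => //; last exact: phi_minimal.
by apply: mul_freeZl => //; rewrite -Jm; exact: init_gen_mem.
Qed.

End Resolution.

(** * Regular systems of parameters adapted to an ideal *)

Section RegularSystems.
Variables (R : comNzRingType) (nR : noetherian R) (m : set R) (d : nat).
Hypotheses (lR : local_ring m) (dimR : krull_dim R d.+1).
Implicit Types (I J E K : set R) (x : 'I_d.+1 -> R) (k : 'I_d.+1) (a b c : R).

(** Regular sequences are ordered; each member of a regular system of
    parameters has to take the last place. *)
Definition put_last x k (j : nat) : R := x (tperm k ord_max (inord j)).

Definition others x k : set R := init_gen (put_last x k) d.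

Lemma put_last_last x k : put_last x k d = x k.
Proof.
rewrite /put_last; have -> : inord d = ord_max :> 'I_d.+1.
  by apply: val_inj; rewrite /= inordK.
by rewrite tpermR.
Qed.

Lemma others_ideal x k : ideal (others x k).
Proof. exact: init_gen_ideal. Qed.

Lemma others_mem x k i : i != k -> others x k (x i).
Proof.
move=> ik; have jd : (tperm k ord_max i < d)%N.
  rewrite ltn_neqAle -ltnS ltn_ord andbT; apply: contra ik => /eqP jd.
  have /(congr1 (tperm k ord_max)) : tperm k ord_max i = ord_max by exact: val_inj.
  by rewrite tpermK tpermR => ->.
by have := init_gen_mem (put_last x k) jd; rewrite /put_last inord_val tpermK.
Qed.

Lemma others_min x k K : ideal K -> (forall i, i != k -> K (x i)) ->
  others x k `<=` K.
Proof.
move=> Kid Kx; apply: init_gen_min => // j jd; apply: Kx; apply/eqP => e.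
have /(congr1 (tperm k ord_max)) := e; rewrite tpermK tpermL => /(congr1 val) /=.
by rewrite inordK ?ltnS ?(ltnW jd) // => jd'; rewrite jd' ltnn in jd.
Qed.

Lemma ideal_gen_range_min x K : ideal K -> (forall i, K (x i)) ->
  ideal_gen (range x) `<=` K.
Proof. by move=> Kid Kx; apply: ideal_gen_sub => // _ [i _ <-]. Qed.

Lemma ideal_gen_range_mem n (x : 'I_n -> R) i : ideal_gen (range x) (x i).
Proof. by apply: ideal_gen_mem; exists i. Qed.

Lemma init_gen_put_last x k : init_gen (put_last x k) d.+1 = ideal_gen (range x).
Proof.
rewrite eqEsubset; split.
  apply: init_gen_min => [|j _]; first exact: ideal_gen_ideal.
  exact: ideal_gen_range_mem.
apply: ideal_gen_range_min => [|i]; first exact: init_gen_ideal.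
have [->|ik] := eqVneq i k; first by rewrite -(put_last_last x k); exact: init_gen_mem.
by apply: (@init_gen_le _ _ d) => //; exact: others_mem.
Qed.

Section FixedSystem.
Variable x : 'I_d.+1 -> R.
Hypothesis xm : regular_sop m x.

Lemma regular_put_last k i : (i <= d)%N ->
  primeI (init_gen (put_last x k) i) /\ ~ init_gen (put_last x k) i (put_last x k i).
Proof.
move=> lid; apply: (regular_init_gen_prime nR lR dimR) => //.
by rewrite init_gen_put_last.
Qed.

Lemma put_last_regular k i a : (i <= d)%N ->
  init_gen (put_last x k) i (a * put_last x k i) -> init_gen (put_last x k) i a.
Proof.
by move=> /(regular_put_last k) [ip ni]; rewrite mulrC => /(primeN ip); apply.
Qed.

Lemma max_decompose k a : m a -> exists c n, others x k n /\ a = n + c * x k.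
Proof.
rewrite -{1}xm -(init_gen_put_last x k) => -[c [n [_ Jn ->]]]; exists c, n; split=> //.
by rewrite put_last_last.
Qed.

Lemma adjoin_max_sqr k :
  adjoin m (others x k) (x k) `<=` adjoin setT (others x k) (x k ^+ 2).
Proof.
have Jid := others_ideal x k.
move=> _ [c [n [/(max_decompose k) [r [j [Jj ->]]] Jn ->]]].
exists r, (n + x k * j); split=> //; last by ring.
by apply: idealD => //; exact: idealM.
Qed.

(** The quotient of [R] by the other members is a discrete valuation ring with
    uniformizer [x k]: an element of [E] whose image has valuation [i] would put
    [x k ^+ i] into [E]. *)
Lemma adjoin_power k n E : ideal E -> others x k `<=` E ->
  (forall i, (i < n)%N -> ~ E (x k ^+ i)) ->
  E `<=` adjoin setT (others x k) (x k ^+ n).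
Proof.
move=> Eid JE; have Jid := others_ideal x k.
elim: n => [|n IHn] nE e Ee.
  by exists e, 0; split=> //; [exact: ideal0|rewrite expr0 mulr1 add0r].
have [i lin|c [j [_ Jj eE]]] := IHn _ e Ee; first by apply: nE; exact: ltnW.
have Ec : E (c * x k ^+ n).
  have -> : c * x k ^+ n = e - j by rewrite eE; ring.
  by apply: idealB => //; exact: JE.
have /(max_decompose k) [r [j' [Jj' cE]]] : m c.
  apply: contrapT => /(local_unit nR lR) [c' cc]; apply: (nE n) => //.
  by rewrite -[x k ^+ n]mul1r -cc -mulrA; exact: idealM.
exists r, (j + x k ^+ n * j'); split=> //; last by rewrite eE cE exprS; ring.
by apply: idealD => //; exact: idealM.
Qed.

(** The coefficient of [x k] in [e] is a unit, so [e] can replace [x k]. *)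
Lemma exchange k e : m e -> ~ adjoin m (others x k) (x k) e ->
  regular_sop m (fun i => if i == k then e else x i).
Proof.
move=> me ne; have [c [n [Jn eE]]] := max_decompose k me.
have [|c' cc] := @local_unit R nR m lR c.
  by move=> mc; apply: ne; exists c, n.
set x' := (fun i => _); rewrite /regular_sop.
have x'k : x' k = e by rewrite /x' eqxx.
have Gid := @ideal_gen_ideal R (range x').
have Gi i : i != k -> ideal_gen (range x') (x i).
  move=> ik; have := ideal_gen_range_mem (x := x') i.
  by rewrite {2}/x' (negPf ik).
rewrite eqEsubset; split.
  apply: ideal_gen_range_min => [|i]; first exact: local_ideal lR.
  rewrite /x'; case: eqP => // _; rewrite -xm; exact: ideal_gen_range_mem.
rewrite -{1}xm; apply: ideal_gen_range_min => // i.
have [->|ik] := eqVneq i k; last exact: Gi.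
have -> : x k = c' * (e - n).
  by rewrite eE -[LHS]mul1r -cc; ring.
apply: (idealM _ Gid); apply: (idealB Gid); last exact: (others_min Gid Gi Jn).
by rewrite -x'k; exact: ideal_gen_range_mem.
Qed.

End FixedSystem.

(** The members in [E] of a system that has as many of them as possible span the
    image of [E] in [m / m ^ 2], since an element of [E] with a unit coefficient
    at another member could be exchanged with it. *)
Lemma adapted_system E : (exists x, regular_sop m x) -> E `<=` m ->
  exists x (S : {set 'I_d.+1}), [/\ regular_sop m x,
    forall i, i \in S -> E (x i) &
    forall k, k \notin S -> E `<=` adjoin m (others x k) (x k)].
Proof.
move=> [x0 x0m] Em.
pose P n := `[< exists x (S : {set 'I_d.+1}),
  [/\ regular_sop m x, forall i, i \in S -> E (x i) & #|S| = n] >].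
have exP : exists n, P n.
  exists 0%N; apply/asboolP; exists x0, finset.set0; split=> //; last exact: cards0.
  by move=> i; rewrite finset.in_set0.
have bP n : P n -> (n <= d.+1)%N.
  by move=> /asboolP [x [S [_ _ <-]]]; rewrite -[X in (_ <= X)%N]card_ord max_card.
have [n /asboolP [x [S [xm ES nS]]] nmax] := ex_maxnP exP bP.
exists x, S; split=> // k kS e Ee; apply: contrapT => ne.
have := nmax n.+1; rewrite ltnn => nP; suff: false by []; apply: nP.
apply/asboolP; exists (fun i => if i == k then e else x i), (k |: S)%SET; split.
- by apply: exchange => //; exact: Em.
- by move=> i; rewrite finset.in_setU1; case: eqP => //= _; exact: ES.
- by rewrite cardsU1 kS nS.
Qed.

End RegularSystems.

(** * The socle and the last differential *)

Section ColonByMaximalIdeal.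
Variables (R : comNzRingType) (m I : set R).
Hypothesis Iid : ideal I.

Lemma sub_colon : I `<=` ideal_colon I m.
Proof. by move=> a Ia b _; exact: idealMr. Qed.

(** An associated prime [(I : g)] of [I] contains [I], hence its radical [m]. *)
Lemma exists_socle : noetherian R -> ~ I 1 -> radical I = m ->
  exists2 a, ideal_colon I m a & ~ I a.
Proof.
move=> nR I1 radI; have [g Ig gp] := exists_associated_prime nR Iid I1.
exists g => // q; rewrite -{1}radI => -[n In]; rewrite mulrC.
by apply: (primeX (n := n) gp); exact: idealMr.
Qed.

End ColonByMaximalIdeal.

Section Socle.
Variables (R : comNzRingType) (m : set R) (d : nat).
Hypotheses (nR : noetherian R) (lR : local_ring m) (dimR : krull_dim R d.+1).
Variables (I : idealr R) (F : nat -> vectType R).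
Variable phi : forall i, 'Hom(F i.+1, F i).
Variable eps : {linear F 0%N -> {ideal_quot I} | \pi_{ideal_quot I} \; *%R}.
Hypothesis resF : minimal_free_resolution m d.+1 phi eps.
Implicit Types (x : 'I_d.+1 -> R) (k : 'I_d.+1).

Let mid : ideal m := local_ideal lR.
Let Iid : ideal [set` I] := idealr_set_ideal I.

Lemma I1_sub_max : I1 (phi d) `<=` m.
Proof. by apply: I1_sub => // f; exact: (phi_minimal mid resF). Qed.

(** For a regular system of parameters, this is the condition on the socle that
    is equivalent to the absence of [x k] from the linear part of the last
    differential. *)
Definition socle_divisible x k : Prop :=
  forall a, ideal_colon [set` I] m a ->
    exists2 b, ideal_colon [set` I] (others x k) b & a - x k * b \in I.

Lemma socle_factor x k n : regular_sop m x ->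
  I1 (phi d) `<=` adjoin setT (others x k) (x k ^+ n.+1) ->
  forall a, ideal_colon [set` I] m a ->
    exists2 b, ideal_colon [set` I] (others x k) b & a - x k ^+ n * b \in I.
Proof.
move=> xm sub a Ia; rewrite -(put_last_last x k); apply: (colon_factor resF).
- by move=> i b lid; exact: (put_last_regular nR lR dimR).
- by move=> f; rewrite put_last_last; apply: mul_freeS sub _ _; exact: I1_mul_free.
- by rewrite init_gen_put_last xm.
Qed.

Lemma socle_divisible_of_I1 x k : regular_sop m x ->
  I1 (phi d) `<=` adjoin m (others x k) (x k) -> socle_divisible x k.
Proof.
move=> xm sub a Ia; have := @socle_factor x k 1 xm _ a Ia; rewrite expr1; apply.
by move=> e /sub; exact: adjoin_max_sqr.
Qed.

Lemma I1_of_socle_divisible x k : regular_sop m x -> socle_divisible x k ->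
  I1 (phi d) `<=` adjoin m (others x k) (x k).
Proof.
move=> xm xk; apply: I1_sub => [|f].
  by apply: adjoin_ideal => //; exact: others_ideal.
rewrite -(put_last_last x k); apply: (colon_factor_converse mid resF).
- by move=> i b lid; exact: (put_last_regular nR lR dimR).
- by rewrite init_gen_put_last xm.
- by rewrite put_last_last.
Qed.

(** If [I1] contained no power of [x k], it would be contained in
    [others x k + (x k ^+ n.+1)] for all [n], and the socle in [I + (x k ^+ n)]
    for all [n], hence in [I]. *)
Lemma I1_power x k : regular_sop m x -> m_primary m [set` I] ->
  (forall i, i != k -> I1 (phi d) (x i)) ->
  exists2 n, I1 (phi d) (x k ^+ n) &
    forall j, (j < n)%N -> ~ I1 (phi d) (x k ^+ j).
Proof.
move=> xm [[_ I1n _] radI] Ex.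
have Eid := I1_ideal (phi d); have JE := others_min Eid Ex.
have [nE|noE] := pselect (exists n, I1 (phi d) (x k ^+ n)).
  have exP : exists n, `[< I1 (phi d) (x k ^+ n) >].
    by case: nE => n En; exists n; apply/asboolP.
  have [n0 /asboolP En nmin] := ex_minnP exP; exists n0 => // j jn /asboolP /nmin.
  by rewrite leqNgt jn.
have [a Ia nIa] := exists_socle Iid nR I1n radI; exfalso; apply: nIa.
have /= [n In] : radical [set` I] (x k).
  by rewrite radI -xm; exact: ideal_gen_range_mem.
have [|b _ Iab] := @socle_factor x k n xm _ a Ia.
  by apply: (adjoin_power nR lR xm) => // i _ Ei; apply: noE; exists i.
by apply: (idealBr Iid Iab); exact: idealMr.
Qed.

(** For each [i] one of [k1], [k2], say [k], differs from [i]; writing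
    [a = x k * b] modulo [I], one finds [x i * a = x k * (b * x i)] modulo [m I],
    and [b * x i] is in [I]. *)
Lemma socle_divisible_not_burch x k1 k2 : regular_sop m x -> k1 != k2 ->
  socle_divisible x k1 -> socle_divisible x k2 ->
  ideal_mul m [set` I] = ideal_mul m (ideal_colon [set` I] m).
Proof.
move=> xm k12 div1 div2; have mIid := ideal_mul_ideal m [set` I].
rewrite eqEsubset; split; apply: ideal_mul_sub; try exact: ideal_mul_ideal.
  by move=> p a mp Ia; apply: ideal_mul_mem => //; exact: sub_colon.
have mx i : m (x i) by rewrite -xm; exact: ideal_gen_range_mem.
move=> p a; rewrite -{1}xm => + Ia; move: p.
apply: (@ideal_gen_range_min _ _ _ [set p | ideal_mul m [set` I] (p * a)]).
  split=> [|c u v Iu Iv /=]; first by rewrite /= mul0r; exact: ideal0.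
  by rewrite mulrDl -mulrA; exact: (proj2 mIid).
move=> i /=.
have [k ik [b Ib Iab]] : exists2 k, i != k &
    exists2 b, ideal_colon [set` I] (others x k) b & a - x k * b \in I.
  have [->|ik1] := eqVneq i k1; first by exists k2 => //; exact: div2.
  by exists k1 => //; exact: div1.
have -> : x i * a = x i * (a - x k * b) + x k * (b * x i) by ring.
apply: (idealD mIid); apply: ideal_mul_mem => //.
by apply: Ib; exact: others_mem.
Qed.

(** Modulo [I (I : m)] a product of two elements of [(I : m)] is
    [(x k1 * b) * (x k2 * b') = (b * x k2) * (b' * x k1)], and both factors on
    the right are in [I]. *)
Lemma socle_divisible_square x k1 k2 : regular_sop m x -> k1 != k2 ->
  socle_divisible x k1 -> socle_divisible x k2 ->
  let Im := ideal_colon [set` I] m in ideal_mul Im Im = ideal_mul [set` I] Im.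
Proof.
move=> xm k12 div1 div2 Im.
have Imid : ideal Im by exact: ideal_colon_ideal.
have IIm : [set` I] `<=` Im by exact: sub_colon.
have Pid := ideal_mul_ideal [set` I] Im.
rewrite eqEsubset; split; apply: ideal_mul_sub => //; last first.
- by move=> a b /IIm Ia Ib; exact: ideal_mul_mem.
- exact: ideal_mul_ideal.
move=> a a' Ia Ia'.
have [b Ib Iab] := div1 a Ia; have [b' Ib' Iab'] := div2 a' Ia'.
have Ix1b : Im (x k1 * b).
  have -> : x k1 * b = a - (a - x k1 * b) by ring.
  by apply: (idealB Imid) => //; exact: IIm.
have Ibx : [set` I] (b * x k2) by apply: Ib; apply: others_mem; rewrite eq_sym.
have Ibx' : [set` I] (b' * x k1) by apply: Ib'; exact: others_mem.
have -> : a * a' = (a - x k1 * b) * a' + ((a' - x k2 * b') * (x k1 * b)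
    + (b * x k2) * (b' * x k1)) by ring.
by do !apply: (idealD Pid); apply: ideal_mul_mem => //; exact: IIm.
Qed.

(** In an adapted system, either two members are outside [I1], or [I1] contains
    all members but [x k] and is generated by them and a power of [x k]. *)
Lemma socle_divisible_or_I1 :
  m_primary m [set` I] -> (exists x, regular_sop m x) ->
  (exists x k1 k2, [/\ regular_sop m x, k1 != k2,
     socle_divisible x k1 & socle_divisible x k2])
  \/ exists (x : 'I_d.+1 -> R) (r : nat), [/\ regular_sop m x, (0 < r)%N &
        I1 (phi d) =
        ideal_gen (range (fun i : 'I_d.+1 => if i == 0%N :> nat then x i ^+ r else x i))].
Proof.
move=> primI exm; have Eid := I1_ideal (phi d).
have [x [S [xm ES SE]]] := adapted_system nR lR exm I1_sub_max.
have [[k kS]|nok] := pselect (exists k, forall i, i != k -> i \in S); last first.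
  have noS k : exists2 i, i != k & i \notin S.
    apply: contrapT => no; apply: nok; exists k => i ik; apply: contrapT => iS.
    by apply: no; exists i => //; exact/negP.
  have [k1 _ k1S] := noS ord0; have [k2 k21 k2S] := noS k1.
  left; exists x, k1, k2; split; rewrite 1?eq_sym //.
    by apply: socle_divisible_of_I1 => //; exact: SE.
  by apply: socle_divisible_of_I1 => //; exact: SE.
have Ex i : i != k -> I1 (phi d) (x i) by move=> /kS; exact: ES.
have [r Er rmin] := I1_power xm primI Ex.
right; exists (x \o tperm k ord0), r.
set x' := (fun i : 'I_d.+1 => _).
have x'0 : x' ord0 = x k ^+ r by rewrite /x' /= tpermR.
have x'E i : i != ord0 -> x' i = x (tperm k ord0 i).
  by rewrite /x' /= -val_eqE /= => /negPf ->.
have Gid := @ideal_gen_ideal R (range x').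
split.
- rewrite /regular_sop -xm; congr ideal_gen; rewrite eqEsubset; split.
    by move=> _ [i _ <-]; exists (tperm k ord0 i).
  by move=> _ [i _ <-]; exists (tperm k ord0 i) => //=; rewrite tpermK.
- rewrite lt0n; apply/eqP => r0; move: Er; rewrite r0 expr0 => /I1_sub_max.
  by case: lR => [[]].
rewrite eqEsubset; split.
- move=> e /(adjoin_power nR lR xm Eid (others_min Eid Ex) rmin).
  move: e; apply: (adjoin_min Gid) => [|c _]; last first.
    by apply: (idealM _ Gid); rewrite -x'0; exact: ideal_gen_range_mem.
  apply: (others_min Gid) => i ik.
  have i0 : tperm k ord0 i != ord0.
    by apply: contra ik => /eqP e; rewrite -(tpermK k ord0 i) e tpermR.
  have := ideal_gen_range_mem (x := x') (tperm k ord0 i).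
  by rewrite x'E // tpermK.
- apply: (@ideal_gen_range_min _ _ x' _ Eid) => i.
  have [->|i0] := eqVneq i ord0; first by move: Er; rewrite -x'0.
  rewrite x'E //; apply: Ex; apply: contra i0 => /eqP e.
  by rewrite -(tpermK k ord0 i) e tpermL.
Qed.

End Socle.

(** For [a] in [(I : m)], the element [x_0 a] of [m I] is [x_0 p + x_1 q] with [p],
    [q] in [I].  As [x_0], [x_1] is a regular sequence, [a - p = c x_1] for some
    [c], and then [q = c x_0], so that [c] is in [(I : x_0)]. *)
Lemma not_burch_divisible (R : comNzRingType) (m : set R) (I : idealr R)
    (x : 'I_2 -> R) : noetherian R -> local_ring m -> krull_dim R 2 ->
  regular_sop m x ->
  ideal_mul m [set` I] = ideal_mul m (ideal_colon [set` I] m) ->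
  socle_divisible m I x ord_max.
Proof.
move=> nR lR dimR xm mI a Ia.
have Iid := idealr_set_ideal I.
have neq01 : (ord0 : 'I_2) != ord_max by [].
have i2 (i : 'I_2) : i = ord0 \/ i = ord_max.
  by case: i => [[|[|//]] lti]; [left|right]; exact: val_inj.
pose K := [set c | exists p q,
  [/\ p \in I, q \in I & c = x ord0 * p + x ord_max * q]].
have Kid : ideal K.
  split; first by exists 0, 0; split; [exact: idealr0|exact: idealr0|ring].
  move=> c _ _ [p [q [Ip Iq ->]]] [p' [q' [Ip' Iq' ->]]].
  exists (c * p + p'), (c * q + q').
  by split; [exact: (proj2 Iid)|exact: (proj2 Iid)|ring].
have mIK : ideal_mul m [set` I] `<=` K.
  apply: (ideal_mul_sub Kid) => c e; rewrite -{1}xm => + Ie; move: c.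
  apply: (@ideal_gen_range_min _ _ _ [set c | K (c * e)]).
    split=> [|c u v Ku Kv /=]; first by rewrite /= mul0r; exact: ideal0.
    by rewrite mulrDl -mulrA; exact: (proj2 Kid).
  move=> i /=; case: (i2 i) => ->.
    by exists e, 0; split=> //; [exact: idealr0|ring].
  by exists 0, e; split=> //; [exact: idealr0|ring].
have [p [q [Ip Iq xaE]]] : K (x ord0 * a).
  apply: mIK; rewrite mI; apply: ideal_mul_mem => //.
  by rewrite -xm; exact: ideal_gen_range_mem.
have [Jp nJ] := @regular_put_last R nR m 1 lR dimR x xm ord0 1%N (leqnn 1).
have [zp nz] := @regular_put_last R nR m 1 lR dimR x xm ord0 0%N (leq0n 1).
have put0 : put_last x ord0 0 = x ord_max.
  rewrite /put_last (_ : inord 0 = ord0) ?tpermL //.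
  by apply: val_inj; rewrite /= inordK.
rewrite put_last_last in nJ; rewrite put0 in nz.
have Jx : others x ord0 (x ord_max) by exact: others_mem.
have [c [n [_ n0 apE]]] : others x ord0 (a - p).
  apply: (primeN Jp _ nJ).
  have -> : x ord0 * (a - p) = q * x ord_max by rewrite mulrBr xaE; ring.
  by apply: idealM => //; exact: init_gen_ideal.
move: apE; rewrite put0 n0 add0r => apE.
exists c; last by have -> : a - x ord_max * c = p by [rewrite mulrC -apE; ring].
apply: others_min => [|i].
  split=> [|b u v Iu Iv /=]; first by rewrite /= mulr0; exact: idealr0.
  by rewrite mulrDr mulrCA; exact: (proj2 Iid).
case: (i2 i) => -> // _ /=; suff -> : c * x ord0 = q by [].
apply/eqP; rewrite -subr_eq0; apply/eqP; apply: (primeN zp _ nz).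
have -> : x ord_max * (c * x ord0 - q) =
    x ord0 * (c * x ord_max) - x ord_max * q by ring.
by rewrite -apE mulrBr xaE /=; ring.
Qed.

Theorem theorem6p2 (R : comNzRingType) (m : set R) (d : nat)
    (regR : regular_local_ring m d) (d_ge1 : (1 <= d)%N)
    (I : idealr R) (primI : m_primary m [set` I])
    (F : nat -> vectType R) (phi : forall i : nat, 'Hom(F i.+1, F i))
    (eps : {linear F 0%N -> {ideal_quot I} | \pi_{ideal_quot I} \; *%R})
    (resF : minimal_free_resolution m d phi eps) :
  let cond1 := burch m [set` I] in
  let cond2 := exists (x : 'I_d -> R) (r : nat),
    [/\ regular_sop m x, (0 < r)%N &
        I1 (phi d.-1) =
        ideal_gen (range (fun i : 'I_d => if i == 0%N :> nat then x i ^+ r else x i))] in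
  let cond3 := let Im := ideal_colon [set` I] m in
    ideal_mul Im Im <> ideal_mul [set` I] Im in
  [/\ cond1 -> cond2,
      contains_field R -> cond3 -> cond2 &
      d = 2%N -> cond2 -> cond1].
Proof.
case: d d_ge1 regR resF => [//|d] _ [nR lR dimR exm] resF cond1 cond2 cond3.
have dich := socle_divisible_or_I1 nR lR dimR resF primI exm.
split.
- move=> c1; case: dich => // -[x [k1 [k2 [xm k12 div1 div2]]]].
  by case: c1; exact: socle_divisible_not_burch xm k12 div1 div2.
- move=> _ c3; case: dich => // -[x [k1 [k2 [xm k12 div1 div2]]]].
  by case: c3; exact: socle_divisible_square xm k12 div1 div2.
- rewrite /cond2 => -[d1]; subst d.
  move=> [x [r [xm _ IE]]] mI.
  have xdiv := not_burch_divisible nR lR dimR xm mI.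
  have [c [n [mc Jn xE]]] : adjoin m (others x ord_max) (x ord_max) (x ord_max).
    apply: (I1_of_socle_divisible nR lR dimR resF xm xdiv).
    by rewrite IE; apply: ideal_gen_mem; exists ord_max.
  have [_] := @regular_put_last R nR m 1 lR dimR x xm ord_max 1%N (leqnn 1).
  rewrite put_last_last; apply.
  apply: (@local_saturated R nR m lR _ (others_ideal x ord_max) (1 - c)).
    move=> m1c; have [[mid m1 _] _] := lR; apply: m1.
    exact: (idealBr mid m1c).
  have -> : (1 - c) * x ord_max = n by rewrite mulrBl mul1r {1}xE; ring.
  by [].
Qed.
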